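(* Let $K_n$ be the complete graph on $n \geq 6$ vertices. Then $\rho'(K_n)$ is the minimum number of edges in an asymmetric graph on $n$ vertices. For $n \geq 8$ we have $$n-2-\left\lfloor \frac{n-1}{7}\right\rfloor \leq \rho'(K_n) \leq n-2.$$ Moreover, $\rho'(K_n) \sim n$, i.e. $\rho'(K_n)/n \to 1$ as $n\to\infty$.
   Context: A graph is asymmetric if its only automorphism is the identity (an asymmetric graph on $n$ vertices need not be connected; isolated vertices are allowed). An edge coloring of a graph $G$ is distinguishing if no automorphism of $G$ other than the identity preserves it. The distinguishing index $D'(G)$ is the least number $d$ such that $G$ has a distinguishing edge coloring with $d$ colors. When $D'(G)=2$ (this holds for $K_n$ with $n\ge 6$), the cost of edge-distinguishing $\rho'(G)$ is the least number of edges in the smaller of the two color classes, taken over all distinguishing edge colorings of $G$ with two colors. *)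

(* Defs.v *)
From HB Require Import structures.
From mathcomp Require Import all_boot all_order all_algebra all_fingroup.
From mathcomp Require Import all_classical all_reals all_analysis.

Set Implicit Arguments.
Unset Strict Implicit.
Unset Printing Implicit Defensive.

Definition is_least (P : nat -> Prop) (m : nat) : Prop :=
  P m /\ forall k : nat, P k -> (m <= k)%N.

(* Equal to 0 when no natural number satisfies P. *)
Definition least (P : nat -> Prop) : nat :=
  xget 0%N (fun m : nat => is_least P m).

Record sgraph (T : finType) := SGraph {
  adj :> rel T;
  adj_sym : symmetric adj;
  adj_irr : irreflexive adj
}.

Section Graph.
Variables (T : finType) (G : sgraph T).

Definition edges : {set {set T}} :=
  [set e : {set T} | [exists x, exists y, adj G x y && (e == [set x; y]%SET)]].

Definition automorphism (s : {perm T}) : Prop :=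
  forall x y : T, adj G (s x) (s y) = adj G x y.

Definition asymmetric_graph : Prop :=
  forall s : {perm T}, automorphism s -> s = 1%g.

Definition edge_coloring (d : nat) := {e : {set T} | e \in edges} -> 'I_d.

(* The image of an edge under an automorphism is an edge, but this is not known
   for a bare permutation, hence the relational form. *)
Definition preserves (d : nat) (s : {perm T}) (c : edge_coloring d) : Prop :=
  forall e f : {e : {set T} | e \in edges},
    val f = [set s x | x in val e]%SET -> c f = c e.

Definition distinguishing (d : nat) (c : edge_coloring d) : Prop :=
  forall s : {perm T}, automorphism s -> preserves s c -> s = 1%g.

Definition dist_index : nat :=
  least (fun d => exists c : edge_coloring d, distinguishing c).

Definition color_class_size (d : nat) (c : edge_coloring d) (i : 'I_d) : nat :=
  #|[set e | c e == i]%SET|.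

(* Only meaningful for graphs of distinguishing index 2; equal to 0 otherwise. *)
Definition edge_dist_cost : nat :=
  if dist_index == 2%N then
    least (fun m => exists2 c : edge_coloring 2, distinguishing c
      & m = minn (color_class_size c ord0) (color_class_size c ord_max))
  else 0%N.

End Graph.

Section Complete.
Variable n : nat.

Let neq_ord : rel 'I_n := fun x y => x != y.

Lemma neq_ord_sym : symmetric neq_ord.
Proof. by move=> x y; rewrite /neq_ord eq_sym. Qed.

Lemma neq_ord_irr : irreflexive neq_ord.
Proof. by move=> x; rewrite /neq_ord eqxx. Qed.

Definition complete_graph : sgraph 'I_n := SGraph neq_ord_sym neq_ord_irr.

End Complete.

Definition asymmetric_edge_count (n m : nat) : Prop :=
  exists2 G : sgraph 'I_n, asymmetric_graph G & #|edges G| = m.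

(* Main.v *)
(* A 2-coloring of the edges of K_n is the same thing as a graph on its vertices
   (the edges of the first color), and it is distinguishing exactly when that graph
   is asymmetric; passing to the other color complements the graph.

   Lower bounds: a component with s vertices and e edges has e >= s - 1.  In an
   asymmetric graph at most one component is a single vertex, and a tree with 2 to 6
   vertices always has a symmetry, so e >= s for every component with 2 <= s <= 6.
   Hence 7 e >= 6 s for all components but one.  For the asymptotics, components are
   pairwise nonisomorphic, so the number of those with at most k vertices is bounded
   in terms of k, while all the others satisfy k e >= (k - 1) s.

   Upper bound: an isolated vertex and an asymmetric tree with three legs, of lengths
   1, 2 and at least 3. *)

Require Import Defs.
From HB Require Import structures.
From mathcomp Require Import all_boot all_order all_algebra all_fingroup.
From mathcomp Require Import all_classical all_reals all_analysis.
From mathcomp Require Import zify lra.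
Import Order.TTheory GRing.Theory Num.Theory.
Import numFieldNormedType.Exports.

Set Implicit Arguments.
Unset Strict Implicit.
Unset Printing Implicit Defensive.

(** * Edges as unordered pairs, and rigidity of asymmetric graphs *)

Section Rigidity.
Variables (T : finType) (G : sgraph T).

Lemma mem_edges x y : ([set x; y]%SET \in edges G) = G x y.
Proof.
apply/idP/idP => [|Gxy]; last first.
  by rewrite inE; apply/existsP; exists x; apply/existsP; exists y; rewrite Gxy eqxx.
rewrite inE => /existsP[a /existsP[b /andP[Gab /eqP eqab]]].
have neq_ab : a != b by apply: contraTneq Gab => ->; rewrite adj_irr.
have: a \in [set x; y]%SET by rewrite eqab !inE eqxx.
have: b \in [set x; y]%SET by rewrite eqab !inE eqxx orbT.
rewrite !inE => /orP[]/eqP eb /orP[]/eqP ea; move: neq_ab Gab; rewrite ea eb ?eqxx //.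
by rewrite adj_sym.
Qed.

Lemma edgesP (e : {set T}) :
  reflect (exists x y, G x y /\ e = [set x; y]%SET) (e \in edges G).
Proof.
rewrite inE; apply: (iffP existsP) => [[x /existsP[y /andP[Gxy /eqP->]]]|[x [y [Gxy ->]]]].
  by exists x, y.
by exists x; apply/existsP; exists y; rewrite Gxy eqxx.
Qed.

Hypothesis asymG : asymmetric_graph G.

(** The map sending each entry of [xs] to the entry of [ys] at the same position and fixing all
    other vertices is an automorphism: no edge leaves [xs], and inside it adjacency is preserved
    entrywise. Asymmetry makes it the identity. *)
Lemma asymmetric_seq_eq (xs ys : seq T) :
    uniq xs -> perm_eq xs ys ->
    (forall x y, G x y -> (x \in xs) = (y \in xs)) ->
    (forall x0 i j, i < size xs -> j < size xs ->
       G (nth x0 xs i) (nth x0 xs j) = G (nth x0 ys i) (nth x0 ys j)) ->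
  xs = ys.
Proof.
move=> uxs pxy clo eqG; have sxy := perm_size pxy; have mxy := perm_mem pxy.
have uys : uniq ys by rewrite -(perm_uniq pxy).
pose f x := if x \in xs then nth x ys (index x xs) else x.
have fin x : (f x \in xs) = (x \in xs).
  rewrite /f; case: ifP => // xin.
  by rewrite mxy mem_nth // -sxy index_mem.
have finj : injective f.
  move=> x y eqf; have := fin x; rewrite eqf fin; move: eqf; rewrite /f => eqf eqin.
  move: eqf; rewrite eqin; case: ifP => // xin; rewrite xin in eqin.
  rewrite (set_nth_default y) -?sxy ?index_mem // => /eqP.
  rewrite nth_uniq -?sxy ?index_mem // => /eqP eqi.
  by rewrite -[x](nth_index y xin) -[y in RHS](nth_index y eqin) eqi.
have fid : perm finj = 1%g.
  apply: asymG => x y; rewrite !permE.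
  case xin : (x \in xs); case yin : (y \in xs).
  - rewrite /f xin yin -{3}[x](nth_index x xin) -{3}[y](nth_index x yin).
    rewrite eqG ?index_mem //; congr (G _ _).
    by apply: set_nth_default; rewrite -sxy index_mem.
  - apply/idP/idP=> /clo; first by rewrite !fin xin yin.
    by rewrite xin yin.
  - apply/idP/idP=> /clo; first by rewrite !fin xin yin.
    by rewrite xin yin.
  - by rewrite /f xin yin.
case: xs => [|x0 xs'] in uxs pxy clo eqG sxy mxy f fin finj fid *.
  by move/esym/size0nil: sxy.
apply: (@eq_from_nth _ x0) => // i ilt.
have := permE finj (nth x0 (x0 :: xs') i); rewrite fid perm1 /f mem_nth //.
by rewrite index_uniq // => {1}->; apply: set_nth_default; rewrite -sxy.
Qed.

End Rigidity.

(** * Symmetries of the trees with 2 to 6 vertices, by computation *)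

(* A tree with vertices [0, ..., size p] is encoded by [p], whose [i]-th entry is
   the neighbor of [i.+1] among the smaller vertices. *)
Definition tree_adj (p : seq nat) (i j : nat) : bool :=
  ((0 < i) && (nth 0 p i.-1 == j)) || ((0 < j) && (nth 0 p j.-1 == i)).

(** The vertex [i.+1] chooses its parent freely among the [i.+1] earlier vertices, so there are [m!]
    codes. *)
Fixpoint parent_seqs (m : nat) : seq (seq nat) :=
  if m is m'.+1 then [seq rcons p j | p <- parent_seqs m', j <- iota 0 m]
  else [:: [::]].

Lemma mem_parent_seqs (p : seq nat) :
  (forall i, i < size p -> nth 0 p i <= i) -> p \in parent_seqs (size p).
Proof.
elim/last_ind: p => [//|p j IHp] ltp; rewrite size_rcons.
apply/allpairsPdep; exists p, j; split=> //.
  apply: IHp => i ilt; have := ltp i; rewrite size_rcons nth_rcons ilt; apply.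
  exact: ltnW.
have := ltp (size p); rewrite size_rcons nth_rcons ltnn eqxx => /(_ (ltnSn _)) jle.
by rewrite mem_iota.
Qed.

Definition preserves_adj (a : rel nat) (s : nat) (t : seq nat) : bool :=
  all (fun i => all (fun j => a i j == a (nth 0 t i) (nth 0 t j)) (iota 0 s))
    (iota 0 s).

Lemma preserves_adjP (a : rel nat) (s : nat) (t : seq nat) :
  reflect (forall i j, i < s -> j < s -> a i j = a (nth 0 t i) (nth 0 t j))
    (preserves_adj a s t).
Proof.
apply: (iffP allP) => [eqa i j ilt jlt|eqa i].
  have /eqa/allP eqi : i \in iota 0 s by rewrite mem_iota.
  by apply/eqP/eqi; rewrite mem_iota.
rewrite mem_iota => ilt; apply/allP => j; rewrite mem_iota => jlt.
by apply/eqP/eqa.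
Qed.

(** Permutations are lists of values, so that the search for a nontrivial symmetry can be
    evaluated. *)
Definition has_symmetry (a : rel nat) (s : nat) : bool :=
  has (fun t => (t != iota 0 s) && preserves_adj a s t) (permutations (iota 0 s)).

(** Evaluation over the 1! + ... + 5! = 153 codes. *)
Lemma small_trees_symmetric :
  all (fun m => all (fun p => has_symmetry (tree_adj p) m.+1) (parent_seqs m))
    (iota 1 5).
Proof. by lazy. Qed.

(** * Components, their edges and their spanning trees *)

Section Components.
Variables (T : finType) (G : sgraph T).

(** Components are indexed by canonical representatives; the set is empty when [r] is not a root. *)
Definition component (r : T) : {set T} := [set x | fingraph.root G x == r]%SET.

Definition component_edges (r : T) : {set {set T}} :=
  [set e in edges G | e \subset component r]%SET.

Let Gsym : connect_sym G.
Proof. exact/sym_connect_sym/adj_sym. Qed.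

Lemma component_closed r x y : G x y -> (x \in component r) = (y \in component r).
Proof. by move=> /connect1/(fingraph.rootP Gsym) eqr; rewrite !inE eqr. Qed.

Lemma sum_card_component : \sum_(r | fingraph.root G r == r) #|component r| = #|T|.
Proof.
rewrite -[RHS]sum1_card.
rewrite [RHS](partition_big (fingraph.root G) (fun r => fingraph.root G r == r)) /=;
  last first.
  by move=> x _; rewrite (fingraph.root_root Gsym).
by apply: eq_bigr => r _; rewrite -sum1_card; apply: eq_bigl => x; rewrite inE.
Qed.

(** After exchanging the sums, an edge can be counted only at the root of its endpoint [x], hence at
    most once. *)
Lemma sum_card_component_edges :
  \sum_(r | fingraph.root G r == r) #|component_edges r| <= #|edges G|.
Proof.
under eq_bigr => r _.
  rewrite -sum1_card; under eq_bigl => e do rewrite inE.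
  over.
rewrite (exchange_big_dep (mem (edges G))) /=; last by move=> r e _ /andP[].
rewrite -sum1_card; apply: leq_sum => e /edgesP[x [y [_ ->]]].
rewrite sum1_card; apply: leq_trans (_ : #|pred1 (fingraph.root G x)| <= 1);
  last by rewrite card1.
apply: subset_leq_card; apply/fintype.subsetP => r; rewrite !inE.
by case/andP => _ /andP[_ /fintype.subsetP/(_ x)]; rewrite !inE eqxx => /(_ isT)/eqP->.
Qed.

(** As long as the list is not the whole component, some edge leaves it; the outer endpoint is
    appended to [xs], and the position of the inner one to [p]. *)
Lemma component_order (r : T) (m : nat) : fingraph.root G r = r -> m < #|component r| ->
  exists xs p, [/\ size xs = m.+1, size p = m, uniq xs, {subset xs <= component r}
    & r \in xs /\
      forall i, i < m -> nth 0 p i <= i /\ G (nth r xs i.+1) (nth r xs (nth 0 p i))].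
Proof.
move=> rr; elim: m => [|m IHm] mlt.
  exists [:: r], [::]; split=> //; last by rewrite inE eqxx.
  by move=> x; rewrite !inE => /eqP->; rewrite rr.
have [xs [p [sxs sp uxs subxs [rxs adjp]]]] := IHm (ltnW mlt).
case: (pickP (fun z : T * T => [&& z.1 \in xs, z.2 \notin xs & G z.1 z.2])).
  move=> [x y] /= /and3P[xin yin Gxy].
  have xlt : index x xs < m.+1 by rewrite -sxs index_mem.
  exists (rcons xs y), (rcons p (index x xs)); split.
  - by rewrite size_rcons sxs.
  - by rewrite size_rcons sp.
  - by rewrite rcons_uniq yin.
  - move=> z; rewrite mem_rcons inE => /predU1P[->|/subxs//].
    by rewrite -(component_closed r Gxy) subxs.
  - split; first by rewrite mem_rcons inE rxs orbT.
    move=> i; rewrite ltnS leq_eqVlt => /predU1P[->|ilt].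
      rewrite !nth_rcons sp sxs ltnn ltnn eqxx eqxx xlt.
      by rewrite nth_index // adj_sym.
    have [ple Gi] := adjp i ilt; rewrite !nth_rcons sp sxs ilt ltnS ilt.
    by rewrite (leq_ltn_trans ple (leqW ilt)).
(* With no edge leaving it, the list contains everything connected to [r], which is too much for its
   size. *)
move=> noedge; have clo : fingraph.closed G (mem xs).
  apply: (intro_closed Gsym) => x y Gxy xin; apply: contraFT (noedge (x, y)) => yin.
  by rewrite /= xin yin.
have: component r \subset xs.
  apply/fintype.subsetP => x; rewrite inE -[X in _ == X]rr => /eqP/(fingraph.rootP Gsym) cxr.
  by rewrite -[x \in xs]/(x \in mem xs) (closed_connect clo cxr).
by move/subset_leq_card; rewrite (card_uniqP uxs) sxs leqNgt mlt.
Qed.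

(* A component with one edge less than vertices is a tree, whose edges join each
   vertex but the first to its parent in a connected enumeration. *)
Lemma component_edges_ge (r : T) : fingraph.root G r = r ->
  #|component r| <= #|component_edges r| \/
  #|component r| = #|component_edges r|.+1 /\
  exists xs p, [/\ uniq xs, xs =i component r, size xs = (size p).+1,
      forall i, i < size p -> nth 0 p i <= i
    & forall x0 i j, i < size xs -> j < size xs ->
      G (nth x0 xs i) (nth x0 xs j) = tree_adj p i j].
Proof.
move=> rr; have rin : r \in component r by rewrite inE rr.
have [m cm] : exists m, #|component r| = m.+1.
  by exists #|component r|.-1; rewrite prednK //; apply/card_gt0P; exists r.
have [|xs [p [sxs sp uxs subxs [rxs adjp]]]] := @component_order r m rr.
  by rewrite cm.
have exs : xs =i component r.
  by apply/subset_cardP; [rewrite (card_uniqP uxs) sxs cm | exact/fintype.subsetP].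
pose ed (i : 'I_m) : {set T} := [set nth r xs i.+1; nth r xs (nth 0 p i)]%SET.
have edin i : ed i \in component_edges r.
  have [ple Gi] := adjp i (ltn_ord i).
  rewrite inE mem_edges Gi; apply/fintype.subsetP => x; rewrite -exs.
  have ilt : i.+1 < size xs by rewrite sxs ltnS.
  rewrite !inE => /orP[]/eqP->; apply: mem_nth => //.
  by apply: leq_ltn_trans ilt; apply: ltnW.
(* For [i < j], the vertex at position [j.+1] comes after both ends of [ed i], so it belongs to
   [ed j] only. *)
have edinj : injective ed.
  have edlt (i j : 'I_m) : i < j -> ed i <> ed j.
    move=> ij eij; have: nth r xs j.+1 \in ed i by rewrite eij !inE eqxx.
    have [ple _] := adjp i (ltn_ord i); have jlt := ltn_ord j.
    have ilt : i.+1 < size xs by rewrite sxs ltnS.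
    have {}jlt : j.+1 < size xs by rewrite sxs ltnS.
    rewrite !inE !nth_uniq //; last by apply: leq_ltn_trans ple (ltnW ilt).
    by case/orP => /eqP ej; move: ij; rewrite -ltnS ej ?ltnn // ltnNge (leq_trans ple).
  move=> i j eij; apply: val_inj.
  by case: (ltngtP i j) => // /edlt; rewrite eij.
have sub_ed : [set ed i | i : 'I_m]%SET \subset component_edges r.
  by apply/fintype.subsetP => _ /imsetP[i _ ->].
have card_ed : #|[set ed i | i : 'I_m]%SET| = m by rewrite card_imset // card_ord.
have := subset_leq_card sub_ed; rewrite card_ed => mle.
have [meq|mlt] := eqVneq m #|component_edges r|; last first.
  by left; rewrite cm ltn_neqAle mlt.
right; split; first by rewrite cm meq.
(* There are as many parent edges as edges, so every edge is a parent edge. *)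
have eq_ed : [set ed i | i : 'I_m]%SET = component_edges r.
  by apply/eqP; rewrite eqEcard sub_ed card_ed meq leqnn.
exists xs, p; split=> //; first by rewrite sxs sp.
  by move=> i; rewrite sp => /adjp[].
move=> x0 i j ilt jlt; rewrite !(set_nth_default r x0) //.
apply/idP/idP => [Gij|/orP[]/andP[lt0 /eqP<-]].
- have: [set nth r xs i; nth r xs j]%SET \in component_edges r.
    rewrite inE mem_edges Gij; apply/fintype.subsetP => x; rewrite -exs.
    by rewrite !inE => /orP[]/eqP->; apply: mem_nth.
  rewrite -eq_ed => /imsetP[k _ eqk].
  have neq_ij : i != j by apply: contraTneq Gij => ->; rewrite adj_irr.
  have: nth r xs i \in ed k by rewrite -eqk !inE eqxx.
  have: nth r xs j \in ed k by rewrite -eqk !inE eqxx orbT.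
  have [ple _] := adjp k (ltn_ord k); have klt := ltn_ord k.
  have {}klt : k.+1 < size xs by rewrite sxs ltnS.
  rewrite !inE !nth_uniq //; try exact: leq_ltn_trans ple (ltnW klt).
  by rewrite /tree_adj; do 2!case/orP => /eqP ?; move: neq_ij; subst i j;
    rewrite ?eqxx ?orbT.
- by case: i lt0 ilt => // i _; rewrite sxs ltnS => /adjp[].
- by case: j lt0 jlt => // j _; rewrite sxs ltnS => /adjp[_]; rewrite adj_sym.
Qed.
End Components.

(** * Lower bounds on the number of edges of an asymmetric graph *)

Section AsymmetricLowerBounds.
Variables (T : finType) (G : sgraph T).
Hypothesis asymG : asymmetric_graph G.

Lemma card_component_gt0 r : fingraph.root G r = r -> 0 < #|component G r|.
Proof. by move=> rr; apply/card_gt0P; exists r; rewrite inE rr. Qed.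

(** Otherwise the component is a tree with 2 to 6 vertices, and the symmetry [t] of its code carries
    over along the enumeration [xs] to the whole graph. *)
Lemma small_component_edges r : fingraph.root G r = r ->
  1 < #|component G r| < 7 -> #|component G r| <= #|component_edges G r|.
Proof.
move=> rr /andP[c_gt1 c_lt7].
have [//|[_ [xs [p [uxs exs sxs ple Gxs]]]]] := component_edges_ge rr.
have cE : #|component G r| = (size p).+1 by rewrite -(eq_card exs) (card_uniqP uxs).
have /(allP small_trees_symmetric)/allP/(_ p (mem_parent_seqs ple)) : size p \in iota 1 5.
  by rewrite mem_iota; move: c_gt1 c_lt7; rewrite cE; clear; lia.
case/hasP => t; rewrite mem_permutations => pt /andP[/eqP neq_t /preserves_adjP Gt].
have st := perm_size pt; rewrite size_iota in st.
have xsE : xs = map (nth r xs) (iota 0 (size p).+1).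
  by rewrite -sxs map_nth_iota0 // take_size.
have eq_xs : xs = map (nth r xs) t.
  apply: (asymmetric_seq_eq asymG) => //.
  - by rewrite {1}xsE perm_map // perm_sym.
  - by move=> x y Gxy; rewrite !exs (component_closed r Gxy).
  - have tlt i : i < size xs -> nth 0 t i < size xs.
      move=> ilt; have : nth 0 t i \in iota 0 (size p).+1.
        by rewrite -(perm_mem pt) mem_nth // st -sxs.
      by rewrite mem_iota sxs.
    move=> x0 i j ilt jlt; rewrite !(set_nth_default r x0) ?size_map ?st -?sxs //.
    rewrite !(nth_map 0) ?st -?sxs // !Gxs ?tlt //.
    by rewrite Gt -?sxs.
(* Since [xs] has no repetition, [eq_xs] forces [t] to be the identity list. *)
case: neq_t; apply: (@eq_from_nth _ 0); rewrite ?size_iota st // => i ilt.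
have tilt : nth 0 t i < (size p).+1.
  have := mem_nth 0 (_ : i < size t); rewrite st (perm_mem pt) mem_iota; exact.
apply/eqP; rewrite nth_iota // add0n -(nth_uniq r _ _ uxs) ?sxs //.
by rewrite {2}eq_xs (nth_map 0) ?st.
Qed.

(** Two distinct components with the same adjacency table could be swapped, which is a nontrivial
    automorphism. *)
Lemma eq_component_root r r' : fingraph.root G r = r -> fingraph.root G r' = r' ->
    #|component G r| = #|component G r'| ->
    (forall i j, i < #|component G r| -> j < #|component G r| ->
      G (nth r (enum (component G r)) i) (nth r (enum (component G r)) j) =
      G (nth r' (enum (component G r')) i) (nth r' (enum (component G r')) j)) ->
  r = r'.
Proof.
move=> rr rr' eqc eqG; have [//|neq_r] := eqVneq r r'.
set xs := enum (component G r) in eqG; set ys := enum (component G r') in eqG.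
have sx : size xs = #|component G r| by rewrite -cardE.
have sy : size ys = #|component G r| by rewrite -cardE eqc.
have disj x : x \in xs -> x \notin ys.
  by rewrite !mem_enum !inE => /eqP->; apply: contra_neq neq_r.
have clo_x x y : G x y -> (x \in xs) = (y \in xs).
  by move=> Gxy; rewrite !mem_enum (component_closed r Gxy).
have clo_y x y : G x y -> (x \in ys) = (y \in ys).
  by move=> Gxy; rewrite !mem_enum (component_closed r' Gxy).
have noG x y : x \in xs -> y \in ys -> G x y = false.
  move=> xin yin; apply/negbTE/negP=> /clo_x; rewrite xin => /esym/disj.
  by rewrite yin.
(* The swap is the rearrangement of [xs ++ ys] into [ys ++ xs]; mixed pairs are nonadjacent on both
   sides. *)
have eq_cat : xs ++ ys = ys ++ xs.
  apply: (asymmetric_seq_eq asymG).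
  - rewrite cat_uniq !enum_uniq andbT; apply/hasPn => x yin.
    by apply: contraL yin => /disj.
  - by rewrite perm_catC.
  - by move=> x y Gxy; rewrite !mem_cat (clo_x _ _ Gxy) (clo_y _ _ Gxy).
  - have eqG' x0 i j : i < size xs -> j < size xs ->
        G (nth x0 xs i) (nth x0 xs j) = G (nth x0 ys i) (nth x0 ys j).
      rewrite sx => ilt jlt; rewrite !(set_nth_default r x0) ?sx ?sy // eqG //.
      by rewrite !(set_nth_default r' r) ?sy.
    move=> x0 i j; rewrite size_cat sx sy => ilt jlt; rewrite !nth_cat sx sy.
    case: ltnP => ic; case: ltnP => jc.
    + by rewrite eqG' ?sx.
    + rewrite noG ?mem_nth ?sx ?sy ?ltn_subLR // adj_sym noG ?mem_nth ?sx ?sy ?ltn_subLR //.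
    + rewrite adj_sym noG ?mem_nth ?sx ?sy ?ltn_subLR // noG ?mem_nth ?sx ?sy ?ltn_subLR //.
    + by rewrite eqG' ?sx ?ltn_subLR.
have rx : r \in xs by rewrite mem_enum inE rr.
have /eqP := congr1 (take #|component G r|) eq_cat.
rewrite -{1}sx -{1}sy !take_size_cat // => /eqP eqxy.
by have := disj _ rx; rewrite -eqxy rx.
Qed.

Lemma card_singleton_components :
  #|[set r | (fingraph.root G r == r) && (#|component G r| == 1)]%SET| <= 1.
Proof.
apply/card_le1_eqP => r r'; rewrite !inE => /andP[/eqP rr /eqP cr] /andP[/eqP rr' /eqP cr'].
apply: eq_component_root => //; first by rewrite cr.
by move=> [|i] [|j]; rewrite cr' // !adj_irr.
Qed.

(** The size and the adjacency table of a component, in a finite type depending on [k] alone. The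
    code is faithful for at most [k] vertices; table entries beyond the size come from the default
    [r]. *)
Definition component_code (k : nat) (r : T) : 'I_k.+1 * {ffun 'I_k.+1 * 'I_k.+1 -> bool} :=
  (inord #|component G r|,
   [ffun ij : 'I_k.+1 * 'I_k.+1 =>
     G (nth r (enum (component G r)) ij.1) (nth r (enum (component G r)) ij.2)]).

Lemma card_small_components (k : nat) :
  #|[set r | (fingraph.root G r == r) && (#|component G r| <= k)]%SET|
    <= #|{: 'I_k.+1 * {ffun 'I_k.+1 * 'I_k.+1 -> bool}}|.
Proof.
rewrite -[X in X <= _](@card_in_imset _ _ (component_code k)) ?max_card //.
move=> r r'; rewrite !inE => /andP[/eqP rr rk] /andP[/eqP rr' rk'] [eqc eqf].
have {}eqc : #|component G r| = #|component G r'|.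
  by have := congr1 val eqc; rewrite /= !inordK.
apply: eq_component_root => // i j ilt jlt.
have := congr1 (fun f : {ffun 'I_k.+1 * 'I_k.+1 -> bool} => f (inord i, inord j)) eqf.
by rewrite !ffunE /= !inordK // ltnS ltnW // (leq_trans _ rk).
Qed.

(** Summation over components: [d] is the deficit allowed to each component satisfying [P]. *)
Lemma sum_component_bound (k d : nat) (P : pred T) :
    (forall r, fingraph.root G r = r ->
      k * #|component G r| <= k * #|component_edges G r| + #|component G r| + d * P r) ->
  k * #|T| <= k * #|edges G| + #|T| + d * #|[set r | (fingraph.root G r == r) && P r]%SET|.
Proof.
move=> bound; have := sum_card_component_edges G.
rewrite -(sum_card_component G) => /(leq_mul (leqnn k)) le_edges.
have -> : #|[set r | (fingraph.root G r == r) && P r]%SET| =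
    \sum_(r | fingraph.root G r == r) P r.
  by rewrite cardsE -sum1_card big_mkcondr.
apply: leq_trans (leq_add (leq_add le_edges (leqnn _)) (leqnn _)).
rewrite !big_distrr -!big_split /=; apply: leq_sum => r /eqP rr.
exact: bound.
Qed.

Lemma asymmetric_edges_ge7 : 7 * #|T| <= 7 * #|edges G| + #|T| + 6.
Proof.
(* Only a single vertex has a deficit, 7 - 1 = 6. From 7 vertices on, having at least [s - 1] edges
   is enough. *)
have := @sum_component_bound 7 6 (fun r => #|component G r| == 1).
have := card_singleton_components; set c1 := #|_| => c1_le1 H.
apply: leq_trans (H _) _; last by rewrite leq_add2l; move: c1_le1; clear; lia.
move=> r rr; have := card_component_gt0 rr.
have := @small_component_edges r rr; have := component_edges_ge rr.
move: #|component G r| #|component_edges G r| => s e [|[+ _]]; clear; lia.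
Qed.

Lemma asymmetric_edges_ge (k : nat) :
  k * #|T| <= k * #|edges G| + #|T| +
    k * #|{: 'I_k.+1 * {ffun 'I_k.+1 * 'I_k.+1 -> bool}}|.
Proof.
(* A deficit of [k] covers one missing edge in a small component; beyond [k] vertices, the term [s]
   covers it. *)
have := @sum_component_bound k k (fun r => #|component G r| <= k).
move=> H; apply: leq_trans (H _) _.
  move=> r rr; have := component_edges_ge rr.
  move: #|component G r| #|component_edges G r| => s e [|[+ _]]; clear; nia.
by rewrite leq_add2l leq_mul2l card_small_components orbT.
Qed.

End AsymmetricLowerBounds.

(** * Construction of asymmetric graphs with few edges *)

Definition nat_graph (n : nat) (a : rel nat) (a_sym : symmetric a)
    (a_irr : irreflexive a) : sgraph 'I_n :=
  @SGraph 'I_n (fun x y => a x y) (fun x y => a_sym x y) (fun x => a_irr x).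

(** The values of an automorphism form one of the lists tested by [has_symmetry]. *)
Lemma nat_graph_asymmetric n a a_sym a_irr :
  ~~ has_symmetry a n -> asymmetric_graph (@nat_graph n a a_sym a_irr).
Proof.
move=> /hasPn nosym s auts; pose t := [seq val (s i) | i <- enum 'I_n].
have nth_t (i : 'I_n) : nth 0 t i = s i.
  by rewrite (nth_map i) ?size_enum_ord // nth_ord_enum.
have pt : perm_eq t (iota 0 n).
  rewrite -val_enum_ord /t map_comp; apply/perm_map/uniq_perm.
  - by rewrite map_inj_uniq ?enum_uniq //; apply: perm_inj.
  - exact: enum_uniq.
  - move=> i; rewrite mem_enum -[i in LHS](permKV s) map_f ?mem_enum //.
have /nosym : t \in permutations (iota 0 n) by rewrite mem_permutations.
rewrite negb_and negbK => /orP[/eqP tE|/preserves_adjP[]].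
  by apply/permP => i; apply: val_inj; rewrite perm1 /= -nth_t tE nth_iota.
move=> i j ilt jlt; have := auts (Ordinal ilt) (Ordinal jlt).
by rewrite /= -(nth_t (Ordinal ilt)) -(nth_t (Ordinal jlt)) /= => ->.
Qed.

(* A triangle with pendant paths of lengths 0, 1 and 2. *)
Definition tailed_triangle_adj (i j : nat) : bool :=
  let E := [:: (0, 1); (1, 2); (2, 3); (3, 4); (5, 1); (5, 2)] in
  ((i, j) \in E) || ((j, i) \in E).

Lemma tailed_triangle_sym : symmetric tailed_triangle_adj.
Proof. by move=> i j; rewrite /tailed_triangle_adj orbC. Qed.

Lemma tailed_triangle_irr : irreflexive tailed_triangle_adj.
Proof. by move=> [|[|[|[|[|[|i]]]]]]. Qed.

Lemma tailed_triangle_asymmetric :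
  asymmetric_graph (nat_graph 6 tailed_triangle_sym tailed_triangle_irr).
Proof. by apply: nat_graph_asymmetric; lazy. Qed.

(* The tree with legs [1; 0], [m.+1] and [3; ...; m] at the vertex 2; all the
   vertices beyond [m.+1] are isolated. *)
Definition spider_adj (m a b : nat) : bool :=
  [|| (a.+1 == b) && (b <= m), (b.+1 == a) && (a <= m),
      (a == m.+1) && (b == 2) | (a == 2) && (b == m.+1)].

Lemma spider_sym m : symmetric (spider_adj m).
Proof. by move=> a b; rewrite /spider_adj; lia. Qed.

Lemma spider_irr m : 2 <= m -> irreflexive (spider_adj m).
Proof. by move=> m_ge2 a; rewrite /spider_adj; lia. Qed.

(** The branch vertex is fixed by its degree, the legs by their different lengths, and then each leg
    vertex by vertex. Stating this for functions on [nat] leaves the case analyses to linear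
    arithmetic. *)
Lemma spider_rigid (m n : nat) (f : nat -> nat) :
    5 <= m -> m.+1 < n <= m.+3 -> (forall i, i < n -> f i < n) ->
    (forall i j, i < n -> j < n -> f i = f j -> i = j) ->
    (forall i j, i < n -> j < n -> spider_adj m i j -> spider_adj m (f i) (f j)) ->
  forall i, i < n -> f i = i.
Proof.
move=> m_ge5 /andP[lt_mn le_nm] f_lt f_inj f_adj.
have E i j : i <= m.+1 -> j <= m.+1 -> spider_adj m i j -> spider_adj m (f i) (f j).
  by move=> ile jle; apply: f_adj; apply: leq_ltn_trans lt_mn.
have D i j : i <= m.+1 -> j <= m.+1 -> i != j -> f i != f j.
  move=> ile jle; apply: contra_neq; apply: f_inj; exact: leq_ltn_trans lt_mn.
have adj_succ i : i < m -> spider_adj m i i.+1.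
  by move=> ilt; rewrite /spider_adj eqxx ilt.
have E01 := E 0 1 ltac:(lia) ltac:(lia) (adj_succ 0 ltac:(lia)).
have E12 := E 1 2 ltac:(lia) ltac:(lia) (adj_succ 1 ltac:(lia)).
have E23 := E 2 3 ltac:(lia) ltac:(lia) (adj_succ 2 ltac:(lia)).
have E34 := E 3 4 ltac:(lia) ltac:(lia) (adj_succ 3 ltac:(lia)).
have E45 := E 4 5 ltac:(lia) ltac:(lia) (adj_succ 4 ltac:(lia)).
have E2m : spider_adj m (f 2) (f m.+1).
  by apply: E; [lia | by [] | rewrite /spider_adj !eqxx !orbT].
have D13 := D 1 3 ltac:(lia) ltac:(lia) ltac:(lia).
have D1m := D 1 m.+1 ltac:(lia) ltac:(lia) ltac:(lia).
have D3m := D 3 m.+1 ltac:(lia) ltac:(lia) ltac:(lia).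
have D02 := D 0 2 ltac:(lia) ltac:(lia) ltac:(lia).
have D24 := D 2 4 ltac:(lia) ltac:(lia) ltac:(lia).
have D35 := D 3 5 ltac:(lia) ltac:(lia) ltac:(lia).
(* Only the vertex 2 has three distinct neighbors. *)
have f2 : f 2 = 2.
  clear -m_ge5 E12 E23 E2m D13 D1m D3m; rewrite /spider_adj in E12 E23 E2m; lia.
(* The image of 1 has a neighbor other than 2, so it is not the leaf [m.+1]. If it were 3, the path
   3, 4, 5 would have to fit in the leg 1, 0, which is too short. *)
have f1 : f 1 = 1.
  clear -m_ge5 E01 E12 E23 E34 E45 f2 D02 D24 D35 D13.
  rewrite /spider_adj f2 in E01 E12 E23 E34 E45 D02 D24; lia.
have f3 : f 3 = 3.
  clear -m_ge5 f1 f2 E23 E34 D24 D13.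
  rewrite /spider_adj f2 in E23 E34 D24; lia.
have fm1 : f m.+1 = m.+1.
  clear -m_ge5 f1 f2 f3 E2m D1m D3m; rewrite /spider_adj f2 in E2m; lia.
have f0 : f 0 = 0.
  clear -m_ge5 f1 f2 E01 D02; rewrite /spider_adj f1 in E01; lia.
have f_path i : i < m -> f i = i /\ f i.+1 = i.+1.
  elim: i => [//|i IHi] ilt; have [fi fi1] := IHi (ltnW ilt); split=> //.
  (* At [i = 1] the next vertex follows the branch vertex, so [f3] is used; elsewhere [i.+2] is the
     only neighbor left. *)
  have [->//|i1neq] := eqVneq i 1.
  have := D i i.+2 ltac:(lia) ltac:(lia) ltac:(lia).
  have := E i.+1 i.+2 ltac:(lia) ltac:(lia) (adj_succ i.+1 ilt).
  have [i0|i0] := eqVneq i 0; first by rewrite i0 f2.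
  rewrite fi fi1 /spider_adj; clear -m_ge5 ilt i1neq i0; lia.
have f_le i : i <= m.+1 -> f i = i.
  rewrite leq_eqVlt => /predU1P[->//|]; rewrite ltnS leq_eqVlt => /predU1P[->|/f_path[]//].
  have := f_path m.-1; rewrite prednK; last exact: leq_trans m_ge5.
  by case/(_ (leqnn m)).
move=> i ilt; have [/f_le//|lt_mi] := leqP i m.+1.
(* The only possible vertex outside the tree is isolated; all others being fixed, injectivity fixes
   it too. *)
have ei : i = m.+2 by lia.
have [/f_le ffi|lt_mf] := leqP (f i) m.+1; last by have := f_lt i ilt; lia.
by apply: f_inj => //; apply: f_lt.
Qed.

Lemma spider_asymmetric (m n : nat) (m_ge2 : 2 <= m) : 5 <= m -> m.+1 < n <= m.+3 ->
  asymmetric_graph (nat_graph n (spider_sym m) (spider_irr m_ge2)).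
Proof.
case: n => // n m_ge5 lt_n s auts; apply/permP => i; rewrite perm1; apply: val_inj.
pose f k := val (s (inord k)).
have := @spider_rigid m n.+1 f m_ge5 lt_n; rewrite /f => rigid.
have := rigid _ _ _ i (ltn_ord i); rewrite inord_val; apply=> [k _|j k jlt klt|j k jlt klt].
- exact: ltn_ord.
- by move/val_inj/perm_inj/(congr1 val); rewrite /= !inordK.
- by have := auts (inord j) (inord k); rewrite /= !inordK // => ->.
Qed.

(** The indices below [m] give the path edges, and the last index gives the short leg. *)
Lemma card_spider_edges (m n : nat) (m_ge2 : 2 <= m) : m.+1 < n ->
  #|edges (nat_graph n (spider_sym m) (spider_irr m_ge2))| <= m.+1.
Proof.
case: n => // n lt_mn; set G := nat_graph _ _ _.
pose ed (i : 'I_m.+1) : {set 'I_n.+1} :=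
  if i < m then [set inord i; inord i.+1]%SET else [set inord 2; inord m.+1]%SET.
rewrite -[X in _ <= X]card_ord; apply: leq_trans (leq_imset_card ed 'I_m.+1).
apply/subset_leq_card/fintype.subsetP => _ /edgesP[x [y [Gxy ->]]]; apply/imsetP.
have setE a b : x = a :> nat -> y = b :> nat -> [set x; y]%SET = [set inord a; inord b]%SET.
  by move=> <- <-; rewrite !inord_val.
case/or4P: Gxy => /andP[/eqP e1].
- move=> yle; have xlt : x < m.+1 by rewrite ltnW // ltnS e1.
  exists (Ordinal xlt) => //; rewrite /ed /= ifT ?e1 //; exact: setE.
- move=> xle; have ylt : y < m.+1 by rewrite ltnW // ltnS e1.
  by exists (Ordinal ylt) => //; rewrite /ed /= ifT ?e1 // [RHS]finset.setUC; apply: setE.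
- move/eqP => e2; exists ord_max => //; rewrite /ed /= ltnn [RHS]finset.setUC; exact: setE.
- move/eqP => e2; exists ord_max => //; rewrite /ed /= ltnn; exact: setE.
Qed.

Lemma asymmetric_edge_count_le (n : nat) : 8 <= n ->
  exists2 m, asymmetric_edge_count n m & m <= n - 2.
Proof.
(* With [m = n - 3] the tree has [n - 1] vertices and [n - 2] edges, and one isolated vertex
   remains. *)
move=> n_ge8; have m_ge2 : 2 <= n - 3 by lia.
exists #|edges (nat_graph n (spider_sym (n - 3)) (spider_irr m_ge2))|.
  by eexists; last by []; apply: spider_asymmetric; lia.
by apply: leq_trans (card_spider_edges m_ge2 _) _; lia.
Qed.

Lemma asymmetric_edge_count_ex (n : nat) : 6 <= n ->
  exists m, asymmetric_edge_count n m.
Proof.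
rewrite leq_eqVlt => /predU1P[<-|n_ge7].
  eexists; exists (nat_graph 6 tailed_triangle_sym tailed_triangle_irr) => //.
  exact: tailed_triangle_asymmetric.
(* A spanning tree, with no isolated vertex, already works for [n = 7]. *)
have m_ge2 : 2 <= n - 2 by lia.
eexists; exists (nat_graph n (spider_sym (n - 2)) (spider_irr m_ge2)) => //.
by apply: spider_asymmetric; lia.
Qed.

(** * Two-colorings of the complete graph and graphs on its vertices *)

Lemma least_eq (P : nat -> Prop) (m : nat) : is_least P m -> least P = m.
Proof.
move=> lm; apply: xget_subset1 => // a b [Pa le_a] [Pb le_b].
by apply/eqP; rewrite eqn_leq le_a // le_b.
Qed.

Lemma is_least_least (P : nat -> Prop) (m : nat) : P m -> is_least P (least P).
Proof.
move=> Pm; have exP : exists m, `[< P m >] by exists m; apply/asboolP.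
have [k /asboolP Pk lek] := ex_minnP exP.
have lk : is_least P k by split=> // j Pj; apply/lek/asboolP.
by rewrite (least_eq lk).
Qed.

Lemma imset_pair (T : finType) (s : {perm T}) (x y : T) :
  [set s z | z in [set x; y]%SET]%SET = [set s x; s y]%SET.
Proof. by rewrite imsetU1 imset_set1. Qed.

Section Colorings.
Variable n : nat.
Local Notation K := (complete_graph n).
Local Notation inK := (fun e => e \in edges K).

Lemma complete_automorphism (s : {perm 'I_n}) : automorphism K s.
Proof. by move=> x y /=; rewrite (inj_eq perm_inj). Qed.

Lemma edges_complete (G : sgraph 'I_n) : edges G \subset edges K.
Proof.
apply/fintype.subsetP => _ /edgesP[x [y [Gxy ->]]]; rewrite mem_edges /=.
by apply: contraTneq Gxy => ->; rewrite adj_irr.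
Qed.

Section ColorGraph.
Variables (d : nat) (c : edge_coloring K d) (i : 'I_d).

(** The partial injection [insub] rejects the degenerate pairs [x = y], which are not edges. *)
Definition color_adj (x y : 'I_n) : bool :=
  if insub [set x; y]%SET is Some e then c e == i else false.

Lemma color_adj_sym : symmetric color_adj.
Proof. by move=> x y; rewrite /color_adj finset.setUC. Qed.

Lemma color_adj_irr : irreflexive color_adj.
Proof. by move=> x; rewrite /color_adj insubN // mem_edges adj_irr. Qed.

Definition color_graph : sgraph 'I_n := SGraph color_adj_sym color_adj_irr.

Lemma mem_color_graph e : (val e \in edges color_graph) = (c e == i).
Proof.
have /edgesP[x [y [_ xyE]]] := valP e.
by rewrite xyE mem_edges /= /color_adj -xyE valK.
Qed.

Lemma card_edges_color_graph : #|edges color_graph| = color_class_size c i.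
Proof.
rewrite /color_class_size -[RHS](card_imset _ val_inj); apply: eq_card => e.
apply/idP/imsetP => [eG|[f]]; last by rewrite inE -mem_color_graph => fG ->.
have eK := fintype.subsetP (edges_complete color_graph) e eG.
by exists (Sub e eK) => //; rewrite inE -mem_color_graph.
Qed.

End ColorGraph.

(** With at most two colors, one color class determines the coloring, so its automorphisms preserve
    the coloring. *)
Lemma color_graph_asymmetric (d : nat) (c : edge_coloring K d.+1) i :
  d <= 1 -> distinguishing c -> asymmetric_graph (color_graph c i).
Proof.
move=> d_le1 distc s auts; apply: distc; first exact: complete_automorphism.
move=> e f ef.
have /edgesP[x [y [_ xyE]]] := valP e.
have : (c f == i) = (c e == i).
  by rewrite -!mem_color_graph ef xyE imset_pair !mem_edges auts.
case: (c f) (c e) i d_le1 {auts ef xyE} => [a alt] [b blt] [j jlt] d_le1.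
by rewrite -!val_eqE /= => eqab; apply: val_inj => /=; move: eqab; lia.
Qed.

Section GraphColoring.
Variable G : sgraph 'I_n.

Definition graph_coloring : edge_coloring K 2 :=
  fun e => if val e \in edges G then ord0 else ord_max.

Lemma graph_coloring_distinguishing :
  asymmetric_graph G -> distinguishing graph_coloring.
Proof.
move=> asymG s _ pres; apply: asymG => x y.
have [->|neq_xy] := eqVneq x y; first by rewrite !adj_irr.
have xyK : [set x; y]%SET \in edges K by rewrite mem_edges.
have sxyK : [set s x; s y]%SET \in edges K by rewrite mem_edges /= (inj_eq perm_inj).
have := pres (exist inK _ xyK) (exist inK _ sxyK); rewrite /= imset_pair => /(_ erefl).
by rewrite /graph_coloring /= !mem_edges; do 2!case: ifP.
Qed.

Lemma color_class_size_graph_coloring :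
  color_class_size graph_coloring ord0 = #|edges G|.
Proof.
rewrite -card_edges_color_graph; apply: eq_card => e.
have [eK|eK] := boolP (e \in edges K).
  rewrite -[e in LHS]/(val (exist inK e eK)) mem_color_graph.
  by rewrite /graph_coloring /=; case: ifP.
by rewrite !(contraNF (fintype.subsetP (edges_complete _) e) eK).
Qed.

End GraphColoring.

Lemma dist_index_complete : 6 <= n -> dist_index K = 2.
Proof.
move=> n_ge6; apply: least_eq; split.
  have [_ [G asymG _]] := asymmetric_edge_count_ex n_ge6.
  by exists (graph_coloring G); apply: graph_coloring_distinguishing.
have lt0n : 0 < n by apply: leq_trans n_ge6.
have lt1n : 1 < n by apply: leq_trans n_ge6.
have neq01 : Ordinal lt0n != Ordinal lt1n by [].
(* With no color, an edge cannot be colored; with one color, a transposition preserves the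
   coloring. *)
case=> [|[|//]] [c distc].
  have xyK : [set Ordinal lt0n; Ordinal lt1n]%SET \in edges K by rewrite mem_edges.
  by case: (c (exist inK _ xyK)).
have /permP/(_ (Ordinal lt0n)) : tperm (Ordinal lt0n) (Ordinal lt1n) = 1%g.
  apply: distc => [|e f _]; first exact: complete_automorphism.
  by rewrite !ord1.
by rewrite tpermL perm1.
Qed.

Lemma edge_dist_cost_complete : 6 <= n ->
  is_least (asymmetric_edge_count n) (edge_dist_cost K).
Proof.
move=> n_ge6; rewrite /edge_dist_cost dist_index_complete // eqxx.
set P := fun m : nat => _.
have P_asym m : P m -> asymmetric_edge_count n m.
  move=> [c distc ->]; rewrite /minn; case: ifP => _.
    by exists (color_graph c ord0);
      [exact: color_graph_asymmetric | exact: card_edges_color_graph].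
  by exists (color_graph c ord_max);
    [exact: color_graph_asymmetric | exact: card_edges_color_graph].
(* Only an inequality, because the complement of the graph may have fewer edges. *)
have asym_P m : asymmetric_edge_count n m -> exists2 k, P k & k <= m.
  move=> [G asymG <-].
  exists (minn (color_class_size (graph_coloring G) ord0)
    (color_class_size (graph_coloring G) ord_max)).
    by exists (graph_coloring G) => //; exact: graph_coloring_distinguishing.
  by rewrite color_class_size_graph_coloring geq_minl.
have [m /asym_P[k Pk _]] := asymmetric_edge_count_ex n_ge6.
have [Pl le_l] := is_least_least Pk; split; first exact: P_asym.
by move=> j /asym_P[i Pi le_ij]; apply: leq_trans le_ij; apply: le_l.
Qed.

End Colorings.

(** * Numerical bounds and the limit of the ratio *)

(** The left side is 6(n - 1)/7 rounded up, one more than the lower bound in the theorem. *)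
Lemma asymmetric_edge_count_ge7 n m : 0 < n -> asymmetric_edge_count n m ->
  n - 1 - (n - 1) %/ 7 <= m.
Proof.
move=> n_gt0 [G asymG <-]; have := asymmetric_edges_ge7 asymG.
by rewrite card_ord; lia.
Qed.

Lemma asymmetric_edge_count_ge (k : nat) :
  exists C, forall n m, asymmetric_edge_count n m -> k * n <= k * m + n + C.
Proof.
eexists => n m [G asymG <-].
by have := asymmetric_edges_ge asymG k; rewrite card_ord; apply.
Qed.

Local Open Scope classical_set_scope.
Local Open Scope ring_scope.

Lemma cvg_ratio1 (R : realType) (u : nat -> nat) :
    (\forall n \near \oo, (u n <= n)%N) ->
    (forall k, exists C, \forall n \near \oo, (k * n <= k * u n + n + C)%N) ->
  (fun n : nat => (u n)%:R / n%:R : R) @ \oo --> (1 : R).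
Proof.
move=> u_le u_ge; apply/cvgrPdist_le => e e_gt0.
(* Division by [k * n] leaves an error 1/k + C/(k n), at most 2/k once [n >= C]. *)
have [k k_gt] : exists k : nat, 2 / e < k%:R.
  by exists (Num.truncn (2 / e)).+1; exact: truncnS_gt.
have [C u_geC] := u_ge k.
near=> n.
have n_gt0 : 0 < n%:R :> R by rewrite ltr0n; near: n; exact: nbhs_infty_gt.
have n_ge : C%:R <= n%:R :> R by rewrite ler_nat; near: n; exact: nbhs_infty_ge.
have k_gt0 : 0 < k%:R :> R by apply: lt_trans k_gt; rewrite divr_gt0.
have un : (u n)%:R <= n%:R :> R by rewrite ler_nat; near: n.
have : (k * n)%:R <= (k * u n + n + C)%:R :> R by rewrite ler_nat; near: n.
rewrite !natrD !natrM => un_ge.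
rewrite ger0_norm ?subr_ge0 ?ler_pdivrMr ?mul1r //.
rewrite lerBlDr -lerBlDl ler_pdivlMr // -(ler_pM2l k_gt0).
have : 2 * n%:R <= k%:R * e * n%:R.
  by rewrite ler_pM2r // ltW // -ltr_pdivrMr.
lra.
Unshelve. all: by end_near. Qed.

Theorem theorem3p1 (R : realType) :
  (forall n : nat, (6 <= n)%N ->
     is_least (asymmetric_edge_count n) (edge_dist_cost (complete_graph n))) /\
  (forall n : nat, (8 <= n)%N ->
     (n - 2 - (n - 1) %/ 7 <= edge_dist_cost (complete_graph n) <= n - 2)%N) /\
  ((fun n : nat => (edge_dist_cost (complete_graph n))%:R / n%:R : R)
     @ \oo --> (1 : R)).
Proof.
split; first exact: edge_dist_cost_complete.
have bounds n : (8 <= n)%N ->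
    (n - 2 - (n - 1) %/ 7 <= edge_dist_cost (complete_graph n) <= n - 2)%N.
  move=> n_ge8; have [cost_asym cost_le] := edge_dist_cost_complete (ltnW (ltnW n_ge8)).
  apply/andP; split.
    have n_gt0 : (0 < n)%N by apply: leq_trans n_ge8.
    by have := asymmetric_edge_count_ge7 n_gt0 cost_asym; lia.
  have [m /cost_le le_m m_le] := asymmetric_edge_count_le n_ge8.
  exact: leq_trans m_le.
split=> //; apply: cvg_ratio1.
  near=> n; have /bounds/andP[_] : (8 <= n)%N by near: n; exact: nbhs_infty_ge.
  by move/leq_trans; apply; exact: leq_subr.
move=> k; have [C leC] := asymmetric_edge_count_ge k; exists C.
near=> n; have n_ge6 : (6 <= n)%N by near: n; exact: nbhs_infty_ge.
by apply: leC; have [] := edge_dist_cost_complete n_ge6.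
Unshelve. all: by end_near. Qed.
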